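(* For every integer $T\ge1$ and $0<\epsilon<T/32$, optimal-value estimation from censored lost-sales logs has minimax failure probability at least $1/2$ for every finite archive size, already with IID demand, $h_t=p_t=\bar D=1$, $x_1=0$, strict coverage, and usable fraction $r=1$. That is, for every choice of finite per-period log counts $N_1,\ldots,N_T$, $$\inf_{\widehat V}\ \sup\ \mathbb P\bigl(|\widehat V-V_1^*(0)|>\epsilon\bigr)\ \ge\ \tfrac12,$$ where the infimum is over all (possibly randomized) estimators computed from the sales logs and the supremum is over lost-sales instances with IID demand supported on $[0,1]$, $h_t=p_t=1$, $x_1=0$, logging boundaries $b_t^j$ and caps $a_t$ satisfying strict coverage $\mathbb P(D_t<a_t)>1/2$ for every $t$, and with every log qualified, $b_t^j\ge a_t$ for all $t,j$.
   Context: Lost-sales inventory model. Horizon $T$; $u^+=\max\{u,0\}$. Demands $D_1,\ldots,D_T$ are independent with laws supported on $[0,\bar D]$ (here a common law, $\bar D=1$). Holding and shortage coefficients are $h_t,p_t>0$; fixed and per-unit ordering costs, lead time, and terminal salvage value are zero. Starting period $t$ with inventory $x_t\ge0$, the retailer chooses a post-order level $y_t\ge x_t$ before demand and incurs $h_t(y_t-D_t)^++p_t(D_t-y_t)^+$; the next state is $(y_t-D_t)^+$; only sales $\min\{D_t,y_t\}$ are observed. $V_1^*(x)$ is the infimum, over feasible (possibly randomized) policies that use the information then available, of the expected total cost over periods $1,\ldots,T$ from initial inventory $x$. Sales logs: the data are $((Z_t^j,b_t^j):t=1,\ldots,T,\ j=1,\ldots,N_t)$, where the boundary $b_t^j\ge0$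 is known, $Z_t^j=\min\{D_t^j,b_t^j\}$ is observed, and, conditional on the complete boundary array, the latent demands $D_t^j$ are mutually independent with the law of $D_t$. Strict coverage with caps $a_t\in[0,\bar D]$ (nondecreasing in $t$) means $\mathbb P(D_t<a_t)>p_t/(h_t+p_t)$ for every $t$. The usable fraction is at least $r$ if $|\{j:b_t^j\ge a_t\}|\ge rN_t$ for every $t$; $r=1$ means every log reaches its cap. The estimator knows the costs, boundaries and caps but not the demand law. *)

(* Defs.v *)
From HB Require Import structures.
From mathcomp Require Import all_boot all_order all_algebra.
From mathcomp Require Import all_classical all_reals all_analysis.

Set Implicit Arguments.
Unset Strict Implicit.
Unset Printing Implicit Defensive.
Import Order.TTheory GRing.Theory Num.Theory numFieldNormedType.Exports.
Local Open Scope classical_set_scope.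
Local Open Scope ring_scope.

(* Periods are numbered 0, ..., T - 1.  Cost coefficients and demand laws are
   given as sequences indexed by nat, of which only the first T terms matter. *)

Section Control.
Variable R : realType.

(* The t past pairs (post-order level, sales); true demands are not recorded. *)
Definition history (t : nat) : Type := t.-tuple (R * R)%type.

(* When sales are [min d y], the difference [y - min d y] is the next state
   [max (y - d) 0]. *)
Definition inventory (x : R) (t : nat) (hst : history t) : R :=
  last x [seq e.1 - e.2 | e <- hst].

(* A randomized policy: the law of the post-order level given the history. *)
Definition policy : Type := forall t : nat, R.-pker (t.-tuple (R * R)%type) ~> R.

Definition feasible (T : nat) (x : R) (pol : policy) : Prop :=
  forall (t : nat) (hst : history t), (t < T)%N ->
    pol t hst [set y | inventory x hst <= y] = 1%E.

Definition stage_cost (h p y d : R) : R :=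
  h * Num.max (y - d) 0 + p * Num.max (d - y) 0.

(* Expected cost of the n periods t, ..., t + n - 1 from history hst on. *)
Fixpoint cost_to_go (h p : nat -> R) (law : nat -> probability R R)
    (pol : policy) (n t : nat) (hst : history t) : \bar R :=
  if n is n'.+1 then
    (\int[pol t hst]_y \int[law t]_d
       ((stage_cost (h t) (p t) y d)%:E +
        cost_to_go h p law pol n' [tuple of rcons hst (y, Num.min d y)]))%E
  else 0%E.

Definition optimal_value (T : nat) (h p : nat -> R)
    (law : nat -> probability R R) (x : R) : \bar R :=
  ereal_inf [set cost_to_go h p law pol T ([tuple] : history 0) |
             pol in [set pol | feasible T x pol]].

End Control.

Section Logs.
Variables (R : realType) (T : nat) (N : 'I_T -> nat).

Definition log_index := {t : 'I_T & 'I_(N t)}.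

(* Real arrays indexed by the logs, with the product of the Borel
   sigma-algebras. *)
Definition cylinders : set (set (log_index -> R)) :=
  [set C | exists (i : log_index) (A : set R),
     measurable A /\ C = [set z | A (z i)]].

Definition log_array := g_sigma_algebraType cylinders.

Record sales_logs (law : nat -> probability R R) := SalesLogs {
  log_display : measure_display;
  log_space : measurableType log_display;
  log_prob : probability log_space R;
  latent : log_index -> {RV log_prob >-> R};
  boundary : log_index -> {RV log_prob >-> R};
  boundary_ge0 : forall i w, 0 <= boundary i w;
  (* Given the boundary array, the latent demands are mutually independent and
     the one with index i has law [law (tag i)]. *)
  latent_indep : forall (B : set log_array) (A : log_index -> set R),
    measurable B -> (forall i, measurable (A i)) ->
    log_prob [set w | B (fun i => boundary i w) /\ forall i, A i (latent i w)] =
    (log_prob [set w | B (fun i => boundary i w)] *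
     \prod_(i : log_index) law (tag i) (A i))%E }.

Definition boundaries law (L : sales_logs law) (w : log_space L) : log_array :=
  fun i => boundary L i w.

Definition observations law (L : sales_logs law) (w : log_space L) : log_array :=
  fun i => Num.min (latent L i w) (boundary L i w).

(* A randomized estimator: for known caps, the law of the estimate given the
   boundaries and the observations. *)
Definition estimator : Type :=
  ('I_T -> R) -> R.-pker (log_array * log_array)%type ~> R.

Definition strict_coverage (h p : nat -> R) (law : nat -> probability R R)
    (Dbar : R) (caps : 'I_T -> R) : Prop :=
  [/\ forall t, 0 <= caps t <= Dbar,
      forall s t : 'I_T, (s <= t)%N -> caps s <= caps t &
      forall t : 'I_T,
        ((p t / (h t + p t))%:E < law t [set d : R | (d < caps t)%R])%E].

Definition all_qualified law (caps : 'I_T -> R) (L : sales_logs law) : Prop :=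
  forall i w, caps (tag i) <= boundary L i w.

(* IID demand: [demand_law] is the law of the demand in every period. *)
Record iid_instance := IIDInstance {
  demand_law : probability R R;
  caps : 'I_T -> R;
  logs : sales_logs (fun=> demand_law) }.

Definition admissible (h p : nat -> R) (Dbar : R) (I : iid_instance) : Prop :=
  [/\ demand_law I `[0, Dbar]%classic = 1%E,
      strict_coverage h p (fun=> demand_law I) Dbar (caps I) &
      all_qualified (caps I) (logs I)].

Definition failure_prob (h p : nat -> R) (x eps : R) (Vhat : estimator)
    (I : iid_instance) : \bar R :=
  (\int[log_prob (logs I)]_w
     Vhat (caps I) (boundaries w, observations w)
       [set v | eps%:E <
          `|v%:E - optimal_value T h p (fun=> demand_law I) x|])%E.

End Logs.

(* Main.v *)
(* Le Cam's two-point method.  For c in {1/2, 1} let the demand be c with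
   probability 1/4 and 0 with probability 3/4, and let every cap and every
   boundary be 1/2.  Censoring at 1/2 makes the sales logs of both instances
   coincide outcome by outcome.  The demand has median 0, so never ordering is
   optimal and the optimal value is T c / 4.  The two values differ by
   T / 8 > 2 eps, hence no estimate is within eps of both, and the two failure
   probabilities add up to at least 1. *)

Require Import Defs.
From HB Require Import structures.
From mathcomp Require Import all_boot all_order all_algebra.
From mathcomp Require Import all_classical all_reals all_analysis.
From mathcomp Require Import measurable_realfun ring lra.

Set Implicit Arguments.
Unset Strict Implicit.
Unset Printing Implicit Defensive.
Import Order.TTheory GRing.Theory Num.Theory.
Import numFieldNormedType.Exports.
Local Open Scope classical_set_scope.
Local Open Scope ring_scope.

(** * Products of Bernoulli laws over a finite index set *)

Definition outcomes (I : finType) : Type := {ffun I -> bool}.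

HB.instance Definition _ (I : finType) := Finite.on (outcomes I).
HB.instance Definition _ (I : finType) :=
  isPointed.Build (outcomes I) [ffun=> false].
HB.instance Definition _ (I : finType) :=
  @isMeasurable.Build default_measure_display (outcomes I)
    discrete_measurable discrete_measurable0 discrete_measurableC
    discrete_measurableU.

Section bernoulli_product.
Context (R : realType) (I : finType) (p : {i01 R}).

(** As a finite combination of Dirac masses, it inherits sigma-additivity from scaled Dirac
    measures. *)
Definition bernoulli_product (A : set (outcomes I)) : \bar R :=
  (\sum_(w : outcomes I)
     (\prod_(i : I) bernoulli_pmf p%:num (w i))%:E * \d_w A)%E.

Let p01 : 0 <= (p%:num : R) <= 1.
Proof. by apply/andP; split. Qed.

Let weight_ge0 (w : outcomes I) :
  0 <= \prod_(i : I) bernoulli_pmf p%:num (w i).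
Proof. by apply: prodr_ge0 => i _; exact: bernoulli_pmf_ge0. Qed.

Let bernoulli_product0 : bernoulli_product set0 = 0%E.
Proof. by rewrite /bernoulli_product big1// => w _; rewrite measure0 mule0. Qed.

Let bernoulli_product_ge0 A : (0 <= bernoulli_product A)%E.
Proof. by apply: sume_ge0 => w _; rewrite mule_ge0// lee_fin. Qed.

Let bernoulli_product_sigma_additive : semi_sigma_additive bernoulli_product.
Proof.
move=> F mF tF mUF.
under eq_fun do rewrite exchange_big/=.
apply: cvg_nnesum => w _.
  by apply: nearW => n; apply: sume_ge0 => k _; rewrite mule_ge0// lee_fin.
exact: (@measure_semi_sigma_additive _ _ _
  (mscale (NngNum (weight_ge0 w)) \d_w)).
Qed.

HB.instance Definition _ := isMeasure.Build _ _ _ bernoulli_product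
  bernoulli_product0 bernoulli_product_ge0 bernoulli_product_sigma_additive.

(** Distributing the product over the two-term sums gives a sum over all outcomes, and the indicator
    of a box is the product of the indicators of its sides. *)
Lemma bernoulli_product_box (A : I -> set bool) :
  bernoulli_product [set w | forall i, A i (w i)] =
  (\prod_(i : I) bernoulli_prob p%:num (A i))%E.
Proof.
under eq_bigr do rewrite bernoulli_probE// !diracE -!EFinM -EFinD.
rewrite prodEFin.
transitivity ((\prod_(i : I) \sum_(b : bool)
    bernoulli_pmf p%:num b * (b \in A i)%:R)%:E); last first.
  by congr EFin; apply: eq_bigr => i _; rewrite big_bool.
rewrite bigA_distr_bigA/= -sumEFin; apply: eq_bigr => w _.
rewrite diracE -EFinM big_split/=; congr (_ * _)%:E.
rewrite -natr_prod; congr _%:R.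
have [Aw|/existsNP[i Awi]] := pselect (forall i, A i (w i)).
  by rewrite mem_set// big1// => i _; rewrite mem_set.
rewrite memNset; last by move=> /(_ i).
by rewrite (bigD1 i)//= memNset// mul0n.
Qed.

Let bernoulli_productT : bernoulli_product setT = 1%E.
Proof.
have <- : [set w : outcomes I | forall i, [set: bool] (w i)] = setT.
  by apply/seteqP; split.
by rewrite (bernoulli_product_box (fun=> setT)) big1// => i _;
  rewrite probability_setT.
Qed.

HB.instance Definition _ :=
  Measure_isProbability.Build _ _ _ bernoulli_product bernoulli_productT.

End bernoulli_product.

(** * Two-point demand laws *)

Section two_point.
Context {R : realType}.

Lemma quarter_ge0 : 0 <= 4^-1 :> R. Proof. lra. Qed.
Lemma quarter_le1 : 4^-1 <= 1 :> R. Proof. lra. Qed.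
Definition quarter : {i01 R} := Itv01 quarter_ge0 quarter_le1.

Definition two_point (c : R) (b : bool) : R := if b then c else 0.

HB.instance Definition _ c :=
  isMeasurableFun.Build _ _ bool R (two_point c) (fun _ _ _ => Logic.I).

Definition two_point_law (c : R) : probability R R :=
  distribution (bernoulli_prob quarter%:num) (two_point c).

Lemma two_point_lawE (c : R) (A : set R) :
  two_point_law c A = ((4^-1)%:E * \d_c A + (3 / 4)%:E * \d_(0%R : R) A)%E.
Proof.
rewrite -[LHS]/(bernoulli_prob 4^-1 (two_point c @^-1` A)).
rewrite bernoulli_probE; last by rewrite quarter_ge0 quarter_le1.
by rewrite (_ : 3 / 4 = 1 - 4^-1); last lra.
Qed.

End two_point.

(* [cost_to_go] integrates functions of the policy that need not be measurable;
   the integral of a nonnegative function is then still the supremum of the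
   integrals of the simple functions below it. *)
Section integral_without_measurability.
Local Open Scope ereal_scope.
Context d (T : measurableType d) (R : realType).
Variable mu : {measure set T -> \bar R}.
Import HBNNSimple.

Lemma ge0_le_integral_nonmeasurable (f g : T -> \bar R) :
  (forall x, 0 <= f x) -> (forall x, f x <= g x) ->
  \int[mu]_x f x <= \int[mu]_x g x.
Proof.
move=> f0 fg; rewrite !ge0_integralTE//; last first.
  by move=> x; exact: le_trans (fg x).
apply: ereal_sup_le => _ [h hf <-]; exists h => //= x.
exact: le_trans (fg x).
Qed.

Lemma ge0_integral_le (f : T -> \bar R) (B : \bar R) :
  (forall x, 0 <= f x) ->
  (forall h : {nnsfun T >-> R}, (forall x, (h x)%:E <= f x) ->
    \int[mu]_x (h x)%:E <= B) ->
  \int[mu]_x f x <= B.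
Proof.
move=> f0 hB; rewrite ge0_integralTE//.
apply: ge_ereal_sup => _ [h hf <-]; rewrite -integralT_nnsfun; exact: hB.
Qed.

End integral_without_measurability.

(** * Integrals against two-point and Dirac laws *)

Section two_point_integral.
Local Open Scope ereal_scope.
Context {R : realType}.
Import HBNNSimple.

Lemma integral_two_point_law (c : R) (f : R -> \bar R) :
  measurable_fun setT f -> (forall x, 0 <= f x) ->
  \int[two_point_law c]_x f x = (4^-1)%:E * f c + (3 / 4)%:E * f 0%R.
Proof.
move=> mf f0; rewrite ge0_integral_distribution// integral_bernoulli_prob//=.
  by rewrite (_ : 3 / 4 = 1 - 4^-1)%R; last lra.
by rewrite quarter_ge0 quarter_le1.
Qed.

(** The exact formula holds for each simple function below [f], whose values at the two atoms are at
    most those of [f]. *)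
Lemma integral_two_point_law_le (c : R) (f : R -> \bar R) :
  (forall x, 0 <= f x) ->
  \int[two_point_law c]_x f x <= (4^-1)%:E * f c + (3 / 4)%:E * f 0%R.
Proof.
move=> f0; apply: ge0_integral_le => // h hf.
rewrite integral_two_point_law//.
- by apply: leeD; apply: lee_wpmul2l => //; rewrite lee_fin; lra.
- exact/measurable_EFinP.
- by move=> x; rewrite lee_fin.
Qed.

Lemma integral_dirac_le d (T : measurableType d) (a : T) (f : T -> \bar R) :
  (forall x, 0 <= f x) -> \int[\d_a]_x f x <= f a.
Proof.
move=> f0; apply: ge0_integral_le => // h hf.
rewrite integral_dirac//; first by rewrite diracT mul1e.
exact/measurable_EFinP.
Qed.

End two_point_integral.

(** * Optimal value under two-point demand *)

Section control.
Context {R : realType}.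

Lemma stage_cost_abs (y d : R) : stage_cost 1 1 y d = `|y - d|.
Proof.
rewrite /stage_cost !mul1r; have [yd|/ltW yd] := leP y d.
  rewrite max_r ?max_l ?subr_ge0 ?subr_le0// add0r distrC.
  by rewrite ger0_norm ?subr_ge0.
by rewrite max_l ?max_r ?subr_ge0 ?subr_le0// addr0 ger0_norm ?subr_ge0.
Qed.

(** Makes the Dirac mass at the current inventory a kernel, hence a policy. The inventory is [x] on
    the empty history and otherwise depends on the last pair only. *)
Lemma measurable_inventory (x : R) (t : nat) :
  measurable_fun setT (@inventory R x t).
Proof.
case: t => [|t].
  by apply: (eq_measurable_fun (cst x)) => // h _; rewrite tuple0.
apply: (eq_measurable_fun (fun h : history R t.+1 =>
  (tnth h ord_max).1 - (tnth h ord_max).2)).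
  move=> h _; rewrite /inventory (last_nth 0) size_map size_tuple/=.
  by rewrite (nth_map (0, 0)) ?size_tuple// (tnth_nth (0, 0)).
apply: measurable_funB.
  apply: (measurableT_comp measurable_fst); exact: measurable_tnth.
apply: (measurableT_comp measurable_snd); exact: measurable_tnth.
Qed.

Definition order_nothing (x : R) : policy R :=
  fun t => kdirac (@measurable_inventory x t).

Lemma order_nothing_feasible (T : nat) (x : R) : feasible T x (order_nothing x).
Proof.
by move=> t h _; rewrite /= /kdirac diracE mem_set/=.
Qed.

Lemma stage_cost_ge0 (y d : R) : 0 <= stage_cost 1 1 y d.
Proof. by rewrite stage_cost_abs. Qed.

Lemma cost_to_goS (h p : nat -> R) law (pol : policy R) n t
    (hst : history R t) :
  cost_to_go h p law pol n.+1 hst =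
  (\int[pol t hst]_y \int[law t]_d
     ((stage_cost (h t) (p t) y d)%:E +
      cost_to_go h p law pol n [tuple of rcons hst (y, Num.min d y)]))%E.
Proof. by []. Qed.

Lemma cost_to_go_ge0 law (pol : policy R) n t (h : history R t) :
  (0 <= cost_to_go (fun=> 1%R) (fun=> 1%R) law pol n h)%E.
Proof.
elim: n t h => [//|n IH] t h /=.
apply: integral_ge0 => y _; apply: integral_ge0 => d _.
by rewrite adde_ge0// lee_fin stage_cost_ge0.
Qed.

(** Whatever the level [y], a single period has expected cost [|y - c| / 4 + 3 |y| / 4], which is at
    least [c / 4]. *)
Lemma cost_to_go_ge (c : R) (pol : policy R) n t (h : history R t) : 0 <= c ->
  ((n%:R * (c / 4))%:E <=
   cost_to_go (fun=> 1%R) (fun=> 1%R) (fun=> two_point_law c) pol n h)%E.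
Proof.
move=> c0; elim: n t h => [|n IH] t h /=; first by rewrite mul0r.
rewrite -[leLHS]mule1 -(@prob_kernel _ _ _ _ _ (pol t) h).
rewrite -integral_cst//.
apply: ge0_le_integral_nonmeasurable => y /=.
  by rewrite lee_fin mulr_ge0// divr_ge0.
(* Replacing the future cost by its constant lower bound makes the integrand measurable, so the
   exact two-point formula applies. *)
apply: (@le_trans _ _
  (\int[two_point_law c]_d (stage_cost 1 1 y d + n%:R * (c / 4))%:E)%E).
  rewrite integral_two_point_law.
  - rewrite !stage_cost_abs -!EFinM -EFinD lee_fin subr0.
    (* The bound is [(c - y) / 4 + y / 4 + |y| / 2 >= c / 4]. *)
    have := ler_norm y; have := ler_norm (c - y); have := normr_ge0 y.
    rewrite (distrC y c) -[n.+1%:R]natr1; lra.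
  - apply/measurable_EFinP; apply: measurable_funD => //.
    rewrite (_ : stage_cost 1 1 y = fun d => `|y - d|).
      apply: measurableT_comp => //; exact: measurable_funB.
    by apply/funext => d; rewrite stage_cost_abs.
  - by move=> d; rewrite lee_fin addr_ge0 ?stage_cost_ge0// mulr_ge0// divr_ge0.
apply: ge0_le_integral_nonmeasurable => d.
  by rewrite lee_fin addr_ge0 ?stage_cost_ge0// mulr_ge0// divr_ge0.
by rewrite EFinD leeD2l.
Qed.

Lemma integral_order_nothing_le (x : R) t (h : history R t) (f : R -> \bar R) :
  (forall y, 0 <= f y)%E ->
  (\int[order_nothing x t h]_y f y <= f (inventory x h))%E.
Proof. by move=> f0; exact: (integral_dirac_le (inventory x h) f0). Qed.

(** At level 0 each period costs its demand, of mean [c / 4], and leaves the inventory at 0, so the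
    hypothesis on [h] propagates. *)
Lemma cost_to_go_order_nothing_le (c : R) n t (h : history R t) : 0 <= c ->
  inventory 0 h = 0 ->
  (cost_to_go (fun=> 1%R) (fun=> 1%R) (fun=> two_point_law c)
     (order_nothing 0) n h <= (n%:R * (c / 4))%:E)%E.
Proof.
move=> c0; elim: n t h => [|n IH] t h h0; first by rewrite mul0r.
have F0 y d : (0 <= (stage_cost 1 1 y d)%:E +
   cost_to_go (fun=> 1%R) (fun=> 1%R) (fun=> two_point_law c)
     (order_nothing 0) n [tuple of rcons h (y, Num.min d y)])%E.
  by rewrite adde_ge0 ?cost_to_go_ge0// lee_fin stage_cost_ge0.
rewrite cost_to_goS.
apply: (le_trans (integral_order_nothing_le _ _ _)) => [y|].
  by apply: integral_ge0 => d _; exact: F0.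
rewrite h0; apply: (le_trans (integral_two_point_law_le _ _)); first exact: F0.
(* A negative [d] would leave inventory [-d], but both atoms are nonnegative. *)
have next (d : R) : 0 <= d ->
    inventory 0 [tuple of rcons h (0, Num.min d 0)] = 0.
  by move=> d0; rewrite /inventory/= map_rcons last_rcons/= min_r// subrr.
apply: (@le_trans _ _ ((4^-1)%:E * (`|0 - c|%:E + (n%:R * (c / 4))%:E) +
    (3 / 4)%:E * (`|0 - 0|%:E + (n%:R * (c / 4))%:E))%E).
  apply: leeD; (apply: lee_wpmul2l; [by rewrite lee_fin; lra|]).
    rewrite stage_cost_abs; apply: leeD; first exact: lexx.
    by apply: IH; exact: next.
  rewrite stage_cost_abs; apply: leeD; first exact: lexx.
  by apply: IH; exact: next.
rewrite -!EFinD lee_fin -[n.+1%:R]natr1 !sub0r !normrN normr0.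
rewrite ger0_norm//; lra.
Qed.

Lemma optimal_value_two_point (c : R) (T : nat) : 0 <= c ->
  optimal_value T (fun=> 1) (fun=> 1) (fun=> two_point_law c) 0 =
  (T%:R * (c / 4))%:E.
Proof.
move=> c0; apply/eqP; rewrite eq_le; apply/andP; split; last first.
  by apply: le_ereal_inf_tmp => _ [pol _ <-]; exact: cost_to_go_ge.
apply: (le_trans _ (@cost_to_go_order_nothing_le c T 0 [tuple] c0 erefl)).
apply: ereal_inf_lbound; exists (order_nothing 0) => //.
exact: order_nothing_feasible.
Qed.

End control.

(** * The censored archive and its admissibility *)

Section archive.
Context {R : realType} (T : nat) (N : 'I_T -> nat).

Definition latent_demand (c : R) (i : log_index N)
  (w : outcomes (log_index N)) : R := two_point c (w i).

HB.instance Definition _ c i :=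
  isMeasurableFun.Build _ _ (outcomes (log_index N)) R (latent_demand c i)
    (fun _ _ _ => Logic.I).

(** One probability space serves every [c]: only the map from outcomes to latent demands depends on
    [c]. *)
Definition archive_prob : probability (outcomes (log_index N)) R :=
  bernoulli_product quarter.

(** The boundary array is constant, so an event about it is sure or empty; in the sure case the
    product formula for boxes applies. *)
Lemma latent_demand_indep (c b : R) (B : set (log_array R N))
    (A : log_index N -> set R) :
  archive_prob
    [set w | B (fun=> b) /\ forall i, A i (latent_demand c i w)] =
  (archive_prob [set w | B (fun=> b)] *
   \prod_(i : log_index N) two_point_law c (A i))%E.
Proof.
have [Bb|nBb] := pselect (B (fun=> b)).
  rewrite (_ : [set w | B _] = setT); last by apply/seteqP; split.
  rewrite probability_setT mul1e.
  transitivity (archive_prob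
      [set w | forall i, (two_point c @^-1` A i) (w i)]).
    by congr (_ _); apply/seteqP; split => [w []|w].
  exact: bernoulli_product_box.
rewrite (_ : [set w | B _ /\ _] = set0); last first.
  by apply/seteqP; split => [w []|w].
rewrite (_ : [set w | B _] = set0); last by apply/seteqP; split => [w|w].
by rewrite measure0 mul0e.
Qed.

Lemma half_ge0 : 0 <= 2^-1 :> R. Proof. lra. Qed.

Definition two_point_logs (c : R) : sales_logs N (fun=> two_point_law c) :=
  @SalesLogs R T N (fun=> two_point_law c) _ (outcomes (log_index N))
    archive_prob (latent_demand c) (fun=> cst 2^-1)
    (fun _ _ => half_ge0)
    (fun B A _ _ => latent_demand_indep c 2^-1 B A).

Definition two_point_instance (c : R) : iid_instance R N :=
  {| demand_law := two_point_law c; caps := fun=> 2^-1;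
     logs := two_point_logs c |}.

Lemma two_point_admissible (c : R) : 2^-1 <= c <= 1 ->
  admissible (fun=> 1) (fun=> 1) 1 (two_point_instance c).
Proof.
move=> /andP[c1 c2]; split.
- rewrite [LHS]two_point_lawE !diracE !mem_set /= ?in_itv/=.
  + rewrite !mule1 -EFinD; congr EFin; lra.
  + by apply/andP; split; lra.
  + by apply/andP; split; lra.
- split => [t|//|t]; rewrite -[caps _ _]/(2^-1).
    by apply/andP; split; lra.
  (* Since [c >= 1/2], only the atom 0 lies strictly below the cap; its mass 3/4 exceeds the
     critical ratio 1/2. *)
  rewrite [ltRHS]two_point_lawE !diracE memNset/=; last first.
    by apply/negP; rewrite -leNgt.
  rewrite mem_set/=; last lra.
  rewrite mule0 add0e mule1 lte_fin -[1 + 1]/(2 : R); lra.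
- by move=> i w.
Qed.

(** Indistinguishability: a positive demand is recorded as 1/2, so [c] disappears from the data. *)
Lemma observations_two_point (c : R) (w : outcomes (log_index N)) : 2^-1 <= c ->
  @observations R T N _ (two_point_logs c) w = fun i => if w i then 2^-1 else 0.
Proof.
move=> hc; apply/funext => i; rewrite /observations/= /latent_demand /two_point.
by case: (w i); [rewrite min_r|rewrite min_l// half_ge0].
Qed.

End archive.

(** * Testing two separated values *)

Section two_points_method.
Context {R : realType}.

(** By the triangle inequality the two error events cover the line, so the union bound gives total
    mass at least 1. *)
Lemma separated_error_cover d (X : measurableType d) (k : R.-pker X ~> R)
    (x : X) (eps v1 v2 : R) : 2 * eps < `|v1 - v2| ->
  (1 <= k x [set v | eps%:E < `|v%:E - v1%:E|] +
        k x [set v | eps%:E < `|v%:E - v2%:E|])%E.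
Proof.
move=> v12.
have mE (a : R) : measurable [set v : R | (eps%:E < `|v%:E - a%:E|)%E].
  rewrite [X in measurable X](_ : _ =
      (fun v => `|v - a|) @^-1` `]eps, +oo[%classic).
    have mf : measurable_fun setT (fun v : R => `|v - a|).
      by apply: measurableT_comp => //; exact: measurable_funB.
    by rewrite -[X in measurable X]setTI; apply: mf.
  by apply/seteqP; split => v /=; rewrite in_itv/= andbT lte_fin.
rewrite -[leLHS](@prob_kernel _ _ _ _ _ k x).
apply: le_trans (measureU2 (k x) (mE v1) (mE v2)).
rewrite (_ : _ `|` _ = setT)//; apply/seteqP; split => // v _ /=.
rewrite !lte_fin; have [|e1] := ltP eps `|v - v1|; first by left.
right; rewrite ltNge; apply/negP => e2; move: v12; apply/negP; rewrite -leNgt.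
rewrite (_ : v1 - v2 = (v - v2) - (v - v1)); last by ring.
by apply: le_trans (ler_normB _ _) _; lra.
Qed.

End two_points_method.

(** * Failure probabilities of the two instances *)

Section failure.
Context {R : realType} (T : nat) (N : 'I_T -> nat).
Variables (eps : R) (Vhat : estimator R N).

(** On the right [c] survives only in the target value; the measure and the input of the estimator
    are common to all [c]. *)
Lemma failure_prob_two_point (c : R) : 2^-1 <= c ->
  failure_prob (fun=> 1) (fun=> 1) 0 eps Vhat (two_point_instance N c) =
  (\int[archive_prob N]_w
     Vhat (fun=> (2^-1)%R)
       ((fun=> (2^-1)%R), (fun i => if w i then (2^-1)%R else 0%R))
       [set v | eps%:E < `|v%:E - (T%:R * (c / 4))%:E|])%E.
Proof.
move=> hc; apply: eq_integral => w _.
rewrite optimal_value_two_point; last by apply: le_trans hc; lra.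
by rewrite observations_two_point.
Qed.

Lemma failure_prob_sum : eps < T%:R / 32 ->
  (1 <= failure_prob (fun=> 1%R) (fun=> 1%R) 0%R eps Vhat
          (two_point_instance N (2^-1)%R) +
        failure_prob (fun=> 1%R) (fun=> 1%R) 0%R eps Vhat
          (two_point_instance N 1%R))%E.
Proof.
move=> heps; rewrite !failure_prob_two_point//; last lra.
(* On the discrete space of outcomes every function is measurable, so the integrals add up and a
   bound for each outcome suffices. *)
rewrite -ge0_integralD//.
rewrite -[leLHS]mule1 -(probability_setT (archive_prob N)) -integral_cst//.
apply: ge0_le_integral_nonmeasurable => // w.
(* The gap is [T / 8], while [2 * eps < T / 16]. *)
have v12 : 2 * eps < `|T%:R * (2^-1 / 4) - T%:R * (1 / 4)|.
  rewrite -mulrBr normrM normr_nat (_ : `|_ - _| = 8^-1); last first.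
    by rewrite ler0_norm; lra.
  by have := ler0n R T; lra.
rewrite /cst probability_setT; exact: (separated_error_cover (Vhat _) _ v12).
Qed.

End failure.

Theorem proposition2 (R : realType) (T : nat) (eps : R) (N : 'I_T -> nat)
    (hT : (1 <= T)%N) (eps_gt0 : 0 < eps) (eps_lt : eps < T%:R / 32) :
  ((2^-1 : R)%:E <=
   ereal_inf
     [set m | exists Vhat : estimator R N,
        m = ereal_sup
              [set q | exists2 I : iid_instance R N,
                 admissible (fun=> 1%R) (fun=> 1%R) 1%R I &
                 q = failure_prob (fun=> 1%R) (fun=> 1%R) 0%R eps Vhat I]])%E.
Proof.
apply: le_ereal_inf_tmp => _ [Vhat ->].
set s := ereal_sup _.
have le_s (c : R) : 2^-1 <= c <= 1 ->
    (failure_prob (fun=> 1%R) (fun=> 1%R) 0%R eps Vhat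
       (two_point_instance N c) <= s)%E.
  move=> hc; apply: ereal_sup_ubound; exists (two_point_instance N c) => //.
  exact: two_point_admissible.
have : (1 <= s + s)%E.
  apply: le_trans (failure_prob_sum Vhat eps_lt) _.
  by apply: leeD; apply: le_s; apply/andP; split; lra.
(* The supremum is an extended real: [+oo] satisfies the goal, and [-oo] contradicts
   [1 <= s + s]. *)
case: s {le_s} => [r| |//]; last by rewrite !leey.
by rewrite -EFinD !lee_fin; lra.
Qed.
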